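(* Assume $r>0$. For every $m\ge1$, $0\le n\le N$ and $x\ge1$, $$U^{[m]}_n(x)\le V^{[m]}_n(x),\qquad h^{[m]}_n(x)\le f^{[m]}_n(x),\qquad y^{[m]*}_n\le x^{[m]*}_n.$$ Thus random maturity lowers the value and enlarges the exercise region $[y^{[m]*}_n,\infty)\supseteq[x^{[m]*}_n,\infty)$.
   Context: Let $\alpha:=(1+r)^{-1}$ and $\lambda>1$ with $\lambda^{-1}<1+r<\lambda$. Put $p:=\frac{(1+r)-\lambda^{-1}}{\lambda-\lambda^{-1}}$, $q:=1-p$ (both in $(0,1)$), $\widetilde p:=\alpha\lambda p$, $\widetilde q:=\alpha\lambda^{-1}q$ (so $\widetilde p+\widetilde q=1$), $g(x):=x$, and $(\mathcal B\varphi)(x):=\widetilde p\,\varphi((\lambda^{-1}x)\vee1)+\widetilde q\,\varphi(\lambda x)$ for functions $\varphi$ on $[1,\infty)$. Fixed maturity: on $[1,\infty)$, $V^{[0]}_n\equiv0$, $V^{[m]}_0=g$ ($m\ge1$), $V^{[m]}_n=\max\{g+\mathcal BV^{[m-1]}_{n-1},\ \mathcal BV^{[m]}_{n-1}\}$ ($n,m\ge1$); $\Delta V^{[m]}_n:=V^{[m]}_n-V^{[m-1]}_n$; $f^{[m]}_n:=\mathcal B\Delta V^{[m]}_{n-1}$ ($n\ge1$), $f^{[m]}_0:=0$; $x^{[m]*}_n:=\inf\{x\ge1:x\ge f^{[m]}_n(x)\}$. Random maturity: $\widetilde N$ is a random variable with values in $\{0,\dots,N\}$, independent of the price process, with $\mathrm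 P(\widetilde N=N)>0$; $\pi_{n-1}:=\mathrm P(\widetilde N\ge N-n+1\mid\widetilde N\ge N-n)$ and $\mathcal B_n:=\pi_{n-1}\mathcal B$ for $1\le n\le N$. $U^{[0]}_n\equiv0$, $U^{[m]}_0=g$ ($m\ge1$), $U^{[m]}_n=\max\{g+\mathcal B_nU^{[m-1]}_{n-1},\ \mathcal B_nU^{[m]}_{n-1}\}$ ($1\le n\le N$, $m\ge1$); $\Delta U^{[m]}_n:=U^{[m]}_n-U^{[m-1]}_n$; $h^{[m]}_n:=\mathcal B_n\Delta U^{[m]}_{n-1}$ ($n\ge1$), $h^{[m]}_0:=0$; $y^{[m]*}_n:=\inf\{x\ge1:x\ge h^{[m]}_n(x)\}$. *)

(* Defs.v *)
From HB Require Import structures.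
From mathcomp Require Import all_boot all_order all_algebra.
From mathcomp Require Import all_classical all_reals all_analysis.

Set Implicit Arguments.
Unset Strict Implicit.
Unset Printing Implicit Defensive.

Import Order.TTheory GRing.Theory Num.Theory.
Import numFieldNormedType.Exports.

Local Open Scope classical_set_scope.
Local Open Scope ring_scope.

(* Functions on [1, +oo[ are represented by total functions R -> R of which
   only the values on [1, +oo[ are used: for x >= 1 the one-step operator
   evaluates its argument at Num.max (lambda^-1 * x) 1 and lambda * x, which
   are >= 1 again. *)
Section Model.
Context {R : realType}.
Variables (r lambda : R).

Definition alpha : R := (1 + r)^-1.
Definition up_prob : R := ((1 + r) - lambda^-1) / (lambda - lambda^-1).
Definition down_prob : R := 1 - up_prob.
Definition up_tilde : R := alpha * lambda * up_prob.
Definition down_tilde : R := alpha * lambda^-1 * down_prob.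

Definition stepB (phi : R -> R) : R -> R := fun x =>
  up_tilde * phi (Num.max (lambda^-1 * x) 1) + down_tilde * phi (lambda * x).

End Model.

(* The recursion is shared by both maturities: [A k] is the operator leading
   from stage k to stage k.+1. *)
Section Recursion.
Context {R : realType}.
Variable A : nat -> (R -> R) -> R -> R.

Fixpoint value (m n : nat) {struct n} : R -> R :=
  match m, n with
  | 0%N, _ => fun=> 0
  | _.+1, 0%N => fun x => x
  | m'.+1, n'.+1 => fun x =>
      Num.max (x + A n' (value m' n') x) (A n' (value m n') x)
  end.

(* Meaningful for m >= 1 only. *)
Definition delta_value (m n : nat) : R -> R := fun x =>
  value m n x - value m.-1 n x.

Definition obstacle (m n : nat) : R -> R :=
  if n is k.+1 then A k (delta_value m k) else fun=> 0.

End Recursion.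

(* By linearity of the one-step operators, for n >= 1 the inequality
   obstacle A m n x <= x says that exercising, worth
   x + A n.-1 (value A m.-1 n.-1) x, is at least as good as continuing, worth
   A n.-1 (value A m n.-1) x. *)
Definition exercise_region {R : realType} (F : R -> R) : set R :=
  [set x | 1 <= x /\ F x <= x].

(* The infimum is taken in the extended reals, so that inf set0 = +oo. *)
Definition threshold {R : realType} (F : R -> R) : \bar R :=
  ereal_inf (EFin @` exercise_region F).

Definition half_line {R : realType} (a : \bar R) : set R :=
  [set x | (a <= x%:E)%E].

Section RandomMaturity.
Context {d : measure_display} {T : measurableType d} {R : realType}.
Variable P : probability T R.

Definition cond_prob (E F : set T) : R := fine (P (E `&` F)) / fine (P F).

(* pi_ N Nt k is pi_(n-1) for n = k + 1, that is,
   P (Nt >= N - k | Nt >= N - (k + 1)); it is used for k < N only. *)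
Definition pi_ (N : nat) (Nt : T -> nat) (k : nat) : R :=
  cond_prob [set t | (N - k <= Nt t)%N] [set t | (N - k.+1 <= Nt t)%N].

Definition process_sigma_algebra (S : nat -> T -> R) : set (set T) :=
  <<s [set E | exists i (B : set R), measurable B /\ E = S i @^-1` B] >>.

Definition independent_of_process (Nt : T -> nat) (S : nat -> T -> R) : Prop :=
  forall (C : set nat) (E : set T), process_sigma_algebra S E ->
    P ((Nt @^-1` C) `&` E) = (P (Nt @^-1` C) * P E)%E.

End RandomMaturity.

Section Notions.
Context {R : realType}.
Variables (r lambda : R).

Definition V : nat -> nat -> R -> R := value (fun=> stepB r lambda).
Definition f : nat -> nat -> R -> R := obstacle (fun=> stepB r lambda).
Definition x_star (m n : nat) : \bar R := threshold (f m n).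

Context {d : measure_display} {T : measurableType d}.
Variables (P : probability T R) (N : nat) (Nt : T -> nat).

(* stepBn k is the operator B_n for n = k + 1. *)
Definition stepBn (k : nat) (phi : R -> R) : R -> R := fun x =>
  pi_ P N Nt k * stepB r lambda phi x.

Definition U : nat -> nat -> R -> R := value stepBn.
Definition h : nat -> nat -> R -> R := obstacle stepBn.
Definition y_star (m n : nat) : \bar R := threshold (h m n).

End Notions.

(* Main.v *)
Require Import Defs.
From mathcomp Require Import all_boot all_order all_algebra.
From mathcomp Require Import all_classical all_reals all_analysis.
From mathcomp Require Import ring lra.

(* With g x = x, the increments satisfy
     Delta_1 = max g f_1,  Delta_m.+1 = max f_m.+1 (min g f_m)
   (time index omitted), the second one because the obstacles f_m decrease in
   m.  These formulas are monotone in the obstacles, and the one-step operators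
   are positive, so lowering the operators (pi <= 1) lowers the obstacles.  The
   formulas and the operators also preserve the cone of nonnegative
   nondecreasing functions phi on [1, +oo[ for which phi x / x is
   nonincreasing; for such phi the set phi x <= x is upward closed because of
   the last property, and contains its infimum because phi is nondecreasing. *)

Set Implicit Arguments.
Unset Strict Implicit.
Unset Printing Implicit Defensive.

Import Order.TTheory GRing.Theory Num.Theory.
Import numFieldNormedType.Exports.

Local Open Scope classical_set_scope.
Local Open Scope ring_scope.

(** The third clause says that [phi x / x] is nonincreasing, with the denominators cleared. Taking
    [y = x] recovers plain nonnegativity. *)
Definition anchored_monotone {R : realType} (phi : R -> R) : Prop :=
  forall x y : R, 1 <= x -> x <= y ->
    [/\ 0 <= phi x, phi x <= phi y & x * phi y <= y * phi x].

(** * The cone and its exercise regions *)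

Section AnchoredMonotone.
Context {R : realType}.
Implicit Types phi psi : R -> R.

Lemma anchored_monotone_ext phi psi :
  (forall x, 1 <= x -> phi x = psi x) ->
  anchored_monotone phi -> anchored_monotone psi.
Proof.
move=> e c x y x1 xy; have y1 := le_trans x1 xy.
by rewrite -!e//; exact: c.
Qed.

Lemma anchored_monotone0 : anchored_monotone (fun=> 0 : R).
Proof. by move=> x y _ _; rewrite !mulr0. Qed.

Lemma anchored_monotone_id : anchored_monotone (fun x : R => x).
Proof. by move=> x y x1 xy; rewrite mulrC; split => //; lra. Qed.

Lemma anchored_monotone_max phi psi :
  anchored_monotone phi -> anchored_monotone psi ->
  anchored_monotone (fun x => Num.max (phi x) (psi x)).
Proof.
move=> c1 c2 x y x1 xy.
have [a1 a2 a3] := c1 _ _ x1 xy; have [b1 b2 b3] := c2 _ _ x1 xy.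
have x0 : 0 <= x by lra.
have y0 : 0 <= y by lra.
split; first by rewrite le_max a1.
- by rewrite ge_max !le_max a2 b2 orbT.
- by rewrite !maxr_pMr// ge_max !le_max a3 b3 orbT.
Qed.

Lemma anchored_monotone_min phi psi :
  anchored_monotone phi -> anchored_monotone psi ->
  anchored_monotone (fun x => Num.min (phi x) (psi x)).
Proof.
move=> c1 c2 x y x1 xy.
have [a1 a2 a3] := c1 _ _ x1 xy; have [b1 b2 b3] := c2 _ _ x1 xy.
have x0 : 0 <= x by lra.
have y0 : 0 <= y by lra.
split; first by rewrite le_min a1.
- by rewrite le_min !ge_min a2 b2 orbT.
- by rewrite !minr_pMr// le_min !ge_min a3 b3 orbT.
Qed.

Lemma exercise_region_half_line phi :
  anchored_monotone phi ->
  exercise_region phi = half_line (threshold phi).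
Proof.
move=> c; apply/seteqP; split=> x /=.
  by move=> xE; apply: ereal_inf_lbound; exists x.
rewrite /half_line /= => ax.
(* A point [z] strictly above the threshold lies above some [w] of the region; the ratio clause
   carries [phi w <= w] over to [z]. *)
have ge_region z : x < z -> 1 <= z /\ phi z <= z.
  move=> xz.
  have : (threshold phi < z%:E)%E by rewrite (le_lt_trans ax)// lte_fin.
  move=> /ereal_inf_lt[_ [w [w1 pw] <-]]; rewrite lte_fin => /ltW wz.
  split; first exact: le_trans wz.
  have [_ _ wp] := c _ _ w1 wz.
  have w0 : 0 < w by lra.
  rewrite -(ler_pM2l w0) (le_trans wp)// [leRHS]mulrC ler_wpM2l//.
  lra.
have x1 : 1 <= x.
  by apply/ler_addgt0Pr => e e0; have [] := ge_region (x + e) ltac:(lra).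
(* Approach [x] from the right: [phi x <= phi (x + e) <= x + e] for every [e > 0]. *)
split=> //; apply/ler_addgt0Pr => e e0.
have [_ pz] := ge_region (x + e) ltac:(lra).
by have [_ le_phi _] := c x (x + e) x1 ltac:(lra); exact: le_trans pz.
Qed.

Lemma threshold_le phi psi :
  (forall x, 1 <= x -> phi x <= psi x) ->
  (threshold phi <= threshold psi)%E.
Proof.
move=> le; apply: ereal_inf_le_tmp => _ [x [x1 px] <-].
by exists x => //; split=> //; apply: le_trans px; exact: le.
Qed.

End AnchoredMonotone.

(** * One-step operators and increment formulas *)

Section StepOperator.
Context {R : realType} (r lambda : R).

(** Common form of both families of operators: [c = 1] for fixed maturity, [c = pi_] for random
    maturity. *)
Definition scaledB (c : nat -> R) (k : nat) (phi : R -> R) : R -> R :=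
  fun x => c k * stepB r lambda phi x.

Lemma scaledBB c k phi psi x :
  scaledB c k (fun z => phi z - psi z) x
    = scaledB c k phi x - scaledB c k psi x.
Proof. by rewrite /scaledB /stepB; ring. Qed.

Lemma scaledB0 c k x : scaledB c k (fun=> 0) x = 0.
Proof. by rewrite /scaledB /stepB; ring. Qed.

Lemma value0 (A : nat -> (R -> R) -> R -> R) n : value A 0 n = fun=> 0.
Proof. by case: n. Qed.

Lemma delta_value1E c n x : 1 <= x ->
  let A := scaledB c in
  delta_value A 1 n x = Num.max x (obstacle A 1 n x).
Proof.
case: n => [|n] x1 /=; first by rewrite /delta_value subr0 max_l//=; lra.
by rewrite {1}/delta_value scaledBB /= value0 scaledB0 !subr0 addr0.
Qed.

Lemma valueSS c m n x :
  let A := scaledB c in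
  value A m.+1 n.+1 x
    = A n (value A m n) x + Num.max x (obstacle A m.+1 n.+1 x).
Proof. by rewrite /= scaledBB addr_maxr subrKC addrC. Qed.

(** With [a] and [b] the obstacles of [m.+2] and [m.+1], subtracting two instances of [valueSS]
    leaves [b + max x a - max x b]. For [a <= b] this is [max a (min x b)], by cases on the position
    of [x]. *)
Lemma delta_valueSSE c m n x : 1 <= x ->
  let A := scaledB c in
  obstacle A m.+2 n x <= obstacle A m.+1 n x ->
  delta_value A m.+2 n x
    = Num.max (obstacle A m.+2 n x) (Num.min x (obstacle A m.+1 n x)).
Proof.
case: n => [|n] x1 A.
  by move=> _; rewrite /delta_value /= subrr min_r ?maxxx//; lra.
rewrite [LHS](erefl : _ = value A m.+2 n.+1 x - value A m.+1 n.+1 x).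
rewrite !valueSS /= -/A => le21.
have -> : A n (value A m.+1 n) x
          = A n (value A m n) x + A n (delta_value A m.+1 n) x.
  by rewrite /A scaledBB; ring.
set a := A n (delta_value A m.+2 n) x in le21 *.
set b := A n (delta_value A m.+1 n) x in le21 *; set v := A n _ x.
by rewrite !maxEle minEle; do !case: leP => ?; lra.
Qed.

(** * Positivity, and preservation of the cone *)

Hypotheses (lambda_gt1 : 1 < lambda) (no_arbitrage : lambda^-1 < 1 + r < lambda).

Lemma up_tilde_ge0 : 0 <= up_tilde r lambda.
Proof.
have l1 := lambda_gt1; have /andP[? ?] := no_arbitrage.
have l0 : 0 < lambda^-1 by rewrite invr_gt0; lra.
by rewrite /up_tilde /alpha /up_prob !mulr_ge0 ?invr_ge0//; lra.
Qed.

Lemma down_tilde_ge0 : 0 <= down_tilde r lambda.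
Proof.
have l1 := lambda_gt1; have /andP[? ?] := no_arbitrage.
have l0 : 0 < lambda^-1 by rewrite invr_gt0; lra.
rewrite /down_tilde /alpha mulr_ge0// ?mulr_ge0 ?invr_ge0//; try lra.
by rewrite /down_prob /up_prob subr_ge0 ler_pdivrMr; lra.
Qed.

Lemma le_max_div_lambda x y : x <= y ->
  Num.max (lambda^-1 * x) 1 <= Num.max (lambda^-1 * y) 1.
Proof.
move=> xy; have l1 := lambda_gt1.
have l0 : 0 <= lambda^-1 by rewrite invr_ge0; lra.
by rewrite ge_max !le_max lexx orbT andbT ler_wpM2l.
Qed.

(** First raise [phi] to [psi] under the factor [c k], then raise the factor; the second step uses
    the sign of [psi]. *)
Lemma scaledB_le c c' k phi psi x :
  0 <= c k -> c k <= c' k ->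
  (forall z, 1 <= z -> 0 <= psi z) ->
  (forall z, 1 <= z -> phi z <= psi z) ->
  1 <= x -> scaledB c k phi x <= scaledB c' k psi x.
Proof.
move=> c0 cc' psi0 le x1; have l1 := lambda_gt1.
have lx : 1 <= lambda * x by nra.
have m1 : 1 <= Num.max (lambda^-1 * x) 1 by rewrite le_max lexx orbT.
have [u0 d0] := (up_tilde_ge0, down_tilde_ge0).
have s0 : 0 <= stepB r lambda psi x.
  by rewrite addr_ge0// mulr_ge0// psi0.
apply: (@le_trans _ _ (c k * stepB r lambda psi x)).
  by rewrite ler_wpM2l// lerD// ler_wpM2l// le.
by rewrite ler_wpM2r.
Qed.

(** Each branch [X] of the price move is nondecreasing with [X / x] nonincreasing, so [phi X / x],
    the product of [phi X / X] and [X / x], is nonincreasing too. *)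
Lemma anchored_monotone_scaledB c k phi : 0 <= c k ->
  anchored_monotone phi -> anchored_monotone (scaledB c k phi).
Proof.
move=> c0 cphi x y x1 xy; have l1 := lambda_gt1.
have [u0 d0] := (up_tilde_ge0, down_tilde_ge0).
have lx : 1 <= lambda * x by nra.
have lxy : lambda * x <= lambda * y by nra.
have m1 z : 1 <= Num.max (lambda^-1 * z) 1 by rewrite le_max lexx orbT.
have [a1 a2 a3] := cphi _ _ (m1 x) (le_max_div_lambda xy).
have [b1 b2 b3] := cphi _ _ lx lxy.
have b4 : x * phi (lambda * y) <= y * phi (lambda * x).
  by rewrite -(@ler_pM2l _ lambda) ?mulrA//; lra.
have a4 : x * phi (Num.max (lambda^-1 * y) 1)
          <= y * phi (Num.max (lambda^-1 * x) 1).
  move: a1 a2 a3.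
  set X := Num.max _ 1; set Y := Num.max (_ * y) 1 => a1 a2 a3.
  have X0 : 0 < X by have := m1 x; rewrite -/X; lra.
  (* [(x / lambda) \/ 1] divided by [x] is nonincreasing *)
  have XY : x * Y <= y * X.
    rewrite /X /Y !maxr_pMr; [|lra|lra].
    by rewrite ge_max !le_max !mulr1 xy orbT andbT mulrCA [y * _]mulrCA
      (mulrC x) lexx.
  rewrite -(ler_pM2l X0) mulrCA.
  apply: (@le_trans _ _ (x * (Y * phi X))); first by rewrite ler_wpM2l//; lra.
  by rewrite !mulrA (mulrC X) ler_wpM2r.
rewrite /scaledB /stepB; split.
- by rewrite mulr_ge0// addr_ge0// mulr_ge0.
- by rewrite ler_wpM2l// lerD// ler_wpM2l.
- rewrite !(mulrCA _ (c k)) ler_wpM2l// !mulrDr lerD//.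
  + by rewrite !(mulrCA _ (up_tilde r lambda)) ler_wpM2l.
  + by rewrite !(mulrCA _ (down_tilde r lambda)) ler_wpM2l.
Qed.

(** Stated at a single time [n], with the obstacle properties as hypotheses, so that it can serve
    inside the induction on [n] that proves them. *)
Lemma anchored_monotone_delta_value c m n :
  let A := scaledB c in
  (forall j x, 1 <= x -> obstacle A j.+2 n x <= obstacle A j.+1 n x) ->
  (forall j, anchored_monotone (obstacle A j.+1 n)) ->
  anchored_monotone (delta_value A m.+1 n).
Proof.
move=> A; case: m => [|m] decr cA.
  apply: (@anchored_monotone_ext _ (fun x => Num.max x (obstacle A 1 n x))).
    by move=> x x1; rewrite delta_value1E.
  exact: anchored_monotone_max anchored_monotone_id (cA _).
apply: (@anchored_monotone_ext _ (fun x =>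
    Num.max (obstacle A m.+2 n x) (Num.min x (obstacle A m.+1 n x)))).
  by move=> x x1; rewrite delta_valueSSE// decr.
apply: anchored_monotone_max (cA _) _.
exact: anchored_monotone_min anchored_monotone_id (cA _).
Qed.

(** The two properties need a joint induction: the increment formula, from which cone membership at
    the next time follows, relies on the decrease in [m]. *)
Lemma obstacle_anchored_monotone_decr c n :
  (forall k, 0 <= c k) ->
  let A := scaledB c in
  (forall m, anchored_monotone (obstacle A m.+1 n)) /\
  (forall m x, 1 <= x -> obstacle A m.+2 n x <= obstacle A m.+1 n x).
Proof.
move=> c0 A; elim: n => [|n [cA decr]].
  by split=> [m|//]; exact: anchored_monotone0.
have cD m : anchored_monotone (delta_value A m.+1 n).
  exact: anchored_monotone_delta_value.
split=> [m|m x x1]; first exact: anchored_monotone_scaledB.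
apply: scaledB_le => // z z1; first by have [] := cD m z z z1 (lexx z).
(* The obstacle of [m.+1] separates the two increments: it bounds that of [m.+2] from above and is a
   term of the maximum giving that of [m.+1]. *)
apply: (@le_trans _ _ (obstacle A m.+1 n z)).
  by rewrite delta_valueSSE ?decr// ge_max decr// ge_min lexx orbT.
case: m => [|m]; first by rewrite delta_value1E// le_max lexx orbT.
by rewrite delta_valueSSE ?decr// le_max lexx.
Qed.

Lemma obstacle_anchored_monotone c m n :
  (forall k, 0 <= c k) -> anchored_monotone (obstacle (scaledB c) m.+1 n).
Proof. by move=> c0; have [] := obstacle_anchored_monotone_decr n c0. Qed.

Lemma obstacle_decr c m n x : (forall k, 0 <= c k) -> 1 <= x ->
  obstacle (scaledB c) m.+2 n x <= obstacle (scaledB c) m.+1 n x.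
Proof.
by move=> c0; have [_] := obstacle_anchored_monotone_decr n c0; exact.
Qed.

(** * Comparison of two families of factors *)

Lemma obstacle_le c c' m n x :
  (forall k, 0 <= c k) -> (forall k, c k <= c' k) -> 1 <= x ->
  obstacle (scaledB c) m.+1 n x <= obstacle (scaledB c') m.+1 n x.
Proof.
move=> c0 cc'; have c'0 k : 0 <= c' k by exact: le_trans (cc' k).
elim: n m x => [//|n IH] m x x1; apply: scaledB_le => // z z1.
  have /(_ z z z1 (lexx z))[]// : anchored_monotone (delta_value (scaledB c') m.+1 n).
  apply: anchored_monotone_delta_value => [j y y1|j]; first exact: obstacle_decr.
  exact: obstacle_anchored_monotone.
case: m => [|m].
  by rewrite !delta_value1E// ge_max !le_max lexx IH// orbT.
rewrite !delta_valueSSE ?obstacle_decr// ge_max !le_max IH//=.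
by apply/orP; right; rewrite le_min !ge_min lexx IH// orbT.
Qed.

Lemma value_ge0 c m n x : (forall k, 0 <= c k) -> 1 <= x ->
  0 <= value (scaledB c) m n x.
Proof.
move=> c0; elim: n m x => [|n IH] [|m] x x1 //=; first lra.
rewrite le_max; apply/orP; right.
(* Writing 0 as the image of the zero function turns positivity into monotonicity. *)
by rewrite -(scaledB0 c n x); apply: scaledB_le => // z; exact: IH.
Qed.

Lemma value_le c c' m n x :
  (forall k, 0 <= c k) -> (forall k, c k <= c' k) -> 1 <= x ->
  value (scaledB c) m n x <= value (scaledB c') m n x.
Proof.
move=> c0 cc'; have c'0 k : 0 <= c' k by exact: le_trans (cc' k).
elim: n m x => [|n IH] [|m] x x1 //=.
have le_step j : scaledB c n (value (scaledB c) j n) x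
                 <= scaledB c' n (value (scaledB c') j n) x.
  by apply: scaledB_le => // z z1; [exact: value_ge0|exact: IH].
by rewrite ge_max !le_max lerD2l !le_step orbT.
Qed.

End StepOperator.

Lemma cond_prob_ge0 d (T : measurableType d) (R : realType)
  (P : probability T R) (E F : set T) : 0 <= cond_prob P E F.
Proof. by rewrite divr_ge0// fine_ge0. Qed.

Lemma cond_prob_le1 d (T : measurableType d) (R : realType)
  (P : probability T R) (E F : set T) :
  measurable E -> measurable F -> cond_prob P E F <= 1.
Proof.
move=> mE mF; have mEF := measurableI _ _ mE mF.
(* Division by zero gives 0, so a null conditioning event respects the bound. *)
have [F0|F0] := eqVneq (fine (P F)) 0.
  by rewrite /cond_prob F0 invr0 mulr0 ler01.
rewrite ler_pdivrMr ?lt_neqAle 1?eq_sym ?F0 ?fine_ge0// mul1r.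
apply: fine_le; rewrite ?fin_num_measure//.
by apply: le_measure; rewrite ?inE.
Qed.

Theorem corollary5p8 (R : realType) (r lambda : R)
    (lambda_gt1 : 1 < lambda)
    (no_arbitrage : lambda^-1 < 1 + r < lambda)
    (r_gt0 : 0 < r)
    (d : measure_display) (T : measurableType d) (P : probability T R)
    (price : nat -> {RV P >-> R})
    (N : nat) (Nt : {RV P >-> nat})
    (Nt_le : forall t : T, (Nt t <= N)%N)
    (Nt_indep : independent_of_process P Nt (fun i => price i))
    (Nt_N : (0 < P [set t | Nt t = N])%E)
    (m n : nat) (m_ge1 : (1 <= m)%N) (n_leN : (n <= N)%N) :
  (forall x : R, 1 <= x ->
     [/\ U r lambda P N Nt m n x <= V r lambda m n x,
         h r lambda P N Nt m n x <= f r lambda m n x &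
         (y_star r lambda P N Nt m n <= x_star r lambda m n)%E]) /\
  [/\ exercise_region (h r lambda P N Nt m n)
        = half_line (y_star r lambda P N Nt m n),
      exercise_region (f r lambda m n) = half_line (x_star r lambda m n) &
      half_line (x_star r lambda m n)
        `<=` half_line (y_star r lambda P N Nt m n)].
Proof.
case: m m_ge1 => [//|m] _.
have pi_ge0 k : 0 <= pi_ P N Nt k by exact: cond_prob_ge0.
have mge k : measurable [set t | (k <= Nt t)%N].
  exact: (measurable_funPTI Nt (_ : measurable [set j | (k <= j)%N])).
(* For [k >= N] truncated subtraction makes both events the whole space. *)
have pi_le1 k : pi_ P N Nt k <= 1 by exact: cond_prob_le1.
have c1 (k : nat) : (0 : R) <= 1 by [].
(* Only the fixed-maturity operators need rewriting; [stepBn] is [scaledB] with factor [pi_] by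
   conversion. *)
have VE : (fun=> stepB r lambda) = scaledB r lambda (fun=> 1).
  by apply/funext => k; apply/funext => phi; apply/funext => x;
    rewrite /scaledB mul1r.
have h_le x : 1 <= x -> h r lambda P N Nt m.+1 n x <= f r lambda m.+1 n x.
  by rewrite /f VE; exact: obstacle_le.
have y_le : (y_star r lambda P N Nt m.+1 n <= x_star r lambda m.+1 n)%E.
  exact: threshold_le.
split=> [x x1|]; first split=> //; first by rewrite /V VE; exact: value_le.
  exact: h_le.
split.
- exact/exercise_region_half_line/obstacle_anchored_monotone.
- by rewrite /x_star /f VE;
    exact/exercise_region_half_line/obstacle_anchored_monotone.
- by move=> x; exact: le_trans.
Qed.
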